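(* Let $m$ be a positive integer, and let $m=m_1+m_2+\cdots+m_e$ be any partition of $m$ into positive integers with $1\le m_1\le m_2\le\cdots\le m_e\le m$. Then there exist a positive integer $k$ and positive integers $n_1,\dots,n_k$ such that $$m=\frac{1}{n_1}+\frac{1}{n_2}+\cdots+\frac{1}{n_k}$$ and $$\Omega\{n_1,\dots,n_k\}=\Big\{\sum_{i\in S} m_i : S\subseteq\{1,\dots,e\}\Big\},$$ where $$\Omega\{n_1,\dots,n_k\}=\Big\{\sum_{i\in I}\frac{1}{n_i} : I\subseteq\{1,\dots,k\}\Big\}\cap\mathbb{Z}.$$ Moreover, the $n_i$ can be chosen so that in addition $$\Big|\Big\{I\subseteq\{1,\dots,k\} : \sum_{i\in I}\frac{1}{n_i}\in\mathbb{Z}\Big\}\Big|=2^e.$$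
   Context: The empty sum (for $S=\emptyset$ or $I=\emptyset$) is taken to be $0$. *)

(* Defs.v *)
From mathcomp Require Import all_boot all_order all_algebra finmap.

Set Implicit Arguments.
Unset Strict Implicit.
Unset Printing Implicit Defensive.

Import GRing.Theory Num.Theory.
Local Open Scope ring_scope.
Local Open Scope fset_scope.

Definition subset_sums (r : nat) (a : 'I_r -> rat) : {fset rat} :=
  [fset \sum_(i in S) a i | S : {set 'I_r} in {: {set 'I_r}}].

(* [n] is an indexed family, so repeated denominators count separately. *)
Definition Omega (k : nat) (n : 'I_k -> nat) : {fset rat} :=
  [fset x in subset_sums (fun i => (n i)%:R^-1) | x \is a Num.int].

(* Main.v *)
Require Import Defs.
From mathcomp Require Import all_boot all_order all_algebra finmap.
From mathcomp Require Import ring zify.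

(** Each part [m_i] is realised by a block of unit fractions of sum [m_i] whose
    only subfamilies of integral sum are the empty one and the whole block.
    Blocks with pairwise coprime common denominators do not interact, so the
    subfamilies of integral sum are then exactly the unions of blocks.

    To build a block of sum [m], take [q - 1] copies of [1/q] for [m] pairwise
    coprime large [q], of product [N]. No nonempty subfamily has an integral
    sum, and the total is [m - c/N] with [0 < c < N] and [c] coprime to [N].
    Choose [q] with [c q = a N + 1]; then [a < q], and adding [a] copies of
    [1/q] brings the total to [m - 1/(N q)], still with no integral subsum.
    Finally add [1/(N q)]: by complementation, a subfamily of integral sum
    containing this last fraction is everything. *)

Set Implicit Arguments.
Unset Strict Implicit.
Unset Printing Implicit Defensive.

Import GRing.Theory Num.Theory.
Local Open Scope ring_scope.

(** * Families of unit fractions over finite types *)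

(** Arbitrary finite index types make concatenation a disjoint sum and avoid shifting indices; only
    the final theorem passes to ordinals. *)
Definition recip_sum (T : finType) (n : T -> nat) (I : {set T}) : rat :=
  \sum_(i in I) (n i)%:R^-1.

Definition common_multiple (T : finType) (n : T -> nat) (N : nat) : Prop :=
  (0 < N)%N /\ forall t, (n t %| N)%N.

Definition zero_sum_free (T : finType) (n : T -> nat) : Prop :=
  forall I : {set T}, recip_sum n I \is a Num.int -> I = set0.

Definition join_fam (T U : finType) (n : T -> nat) (n' : U -> nat)
    (x : T + U) : nat :=
  match x with inl t => n t | inr u => n' u end.

Lemma common_multiple_gt0 (T : finType) (n : T -> nat) N :
  common_multiple n N -> forall t, (0 < n t)%N.
Proof. by case=> N0 nN t; exact: dvdn_gt0 (nN t). Qed.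

Lemma recip_sumM_int (T : finType) (n : T -> nat) N (I : {set T}) :
  common_multiple n N -> recip_sum n I * N%:R \is a Num.int.
Proof.
move=> nN; rewrite /recip_sum mulr_suml; apply: rpred_sum => t _.
have n0 := common_multiple_gt0 nN t.
have /dvdnP [q ->] := nN.2 t.
by rewrite natrM mulrCA mulVf ?mulr1 ?natr_int// pnatr_eq0 -lt0n.
Qed.

Lemma recip_sum_join (T U : finType) (n : T -> nat) (n' : U -> nat)
    (I : {set T + U}) :
  recip_sum (join_fam n n') I =
    recip_sum n (inl @^-1: I) + recip_sum n' (inr @^-1: I).
Proof.
rewrite /recip_sum big_sumType /=.
by congr (_ + _); apply: eq_bigl => x; rewrite inE.
Qed.

Lemma recip_sumT_join (T U : finType) (n : T -> nat) (n' : U -> nat) :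
  recip_sum (join_fam n n') setT = recip_sum n setT + recip_sum n' setT.
Proof. by rewrite recip_sum_join !preimsetT. Qed.

Lemma recip_sum0 (T : finType) (n : T -> nat) : recip_sum n set0 = 0.
Proof. by rewrite /recip_sum big_set0. Qed.

Lemma recip_sumC (T : finType) (n : T -> nat) (I : {set T}) :
  recip_sum n (~: I) = recip_sum n setT - recip_sum n I.
Proof.
apply/eqP; rewrite eq_sym subr_eq addrC; apply/eqP.
rewrite /recip_sum (bigID [in I]) /=.
by congr (_ + _); apply: eq_bigl => x; rewrite !inE.
Qed.

Lemma recip_sum_const (T : finType) (q : nat) (I : {set T}) :
  recip_sum (fun _ => q) I = #|I|%:R / q%:R.
Proof. by rewrite /recip_sum sumr_const mulr_natl. Qed.

Lemma common_multiple_join (T U : finType) (n : T -> nat) (n' : U -> nat) M N :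
  common_multiple n M -> common_multiple n' N ->
  common_multiple (join_fam n n') (M * N).
Proof.
move=> [M0 nM] [N0 nN]; split; first by rewrite muln_gt0 M0.
by case=> x /=; [apply: dvdn_mulr | apply: dvdn_mull].
Qed.

Lemma eq_set_sum (T U : finType) (I J : {set T + U}) :
  inl @^-1: I = inl @^-1: J :> {set T} ->
  inr @^-1: I = inr @^-1: J :> {set U} -> I = J.
Proof.
move=> /setP eT /setP eU; apply/setP => -[x|x].
  by have := eT x; rewrite !inE.
by have := eU x; rewrite !inE.
Qed.

(** * Independence of families with coprime denominators *)

(** Bézout: if [u M = v N + 1], then [x = u (x M) - v (x N)], and [x N = (x + y) N - y N] is
    integral. *)
Lemma coprime_add_int (M N : nat) (x y : rat) :
  (0 < M)%N -> coprime M N ->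
  x * M%:R \is a Num.int -> y * N%:R \is a Num.int ->
  x + y \is a Num.int -> x \is a Num.int.
Proof.
move=> M0 /(coprimeP _ M0) [[u v] /= uv] xM yN xy.
have uvE : (u * M = v * N + 1)%N by lia.
have -> : x = x * M%:R * u%:R - ((x + y) * N%:R - y * N%:R) * v%:R.
  have := congr1 (fun k => k%:R : rat) uvE; rewrite natrD !natrM => e.
  have -> : x * M%:R * u%:R = x * (u%:R * M%:R) by ring.
  by rewrite e; ring.
apply: rpredB; apply: rpredM; rewrite ?natr_int //.
by apply: rpredB => //; rewrite rpredM ?natr_int.
Qed.

Lemma recip_sum_join_int (T U : finType) (n : T -> nat) (n' : U -> nat) M N
    (I : {set T + U}) :
  common_multiple n M -> common_multiple n' N -> coprime M N ->
  recip_sum (join_fam n n') I \is a Num.int ->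
  recip_sum n (inl @^-1: I) \is a Num.int /\
  recip_sum n' (inr @^-1: I) \is a Num.int.
Proof.
move=> nM nN MN; rewrite recip_sum_join => Iint.
have [M0 N0] := (nM.1, nN.1).
split.
  exact: coprime_add_int M0 MN (recip_sumM_int _ nM) (recip_sumM_int _ nN) Iint.
rewrite addrC in Iint; rewrite coprime_sym in MN.
exact: coprime_add_int N0 MN (recip_sumM_int _ nN) (recip_sumM_int _ nM) Iint.
Qed.

Lemma zero_sum_free_join (T U : finType) (n : T -> nat) (n' : U -> nat) M N :
  common_multiple n M -> common_multiple n' N -> coprime M N ->
  zero_sum_free n -> zero_sum_free n' -> zero_sum_free (join_fam n n').
Proof.
move=> nM nN MN zn zn' I /(recip_sum_join_int nM nN MN) [/zn e1 /zn' e2].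
by apply: eq_set_sum; rewrite preimset0.
Qed.

(** * Families without nonempty integral subsums *)

(** A subfamily sums to [#|I| / q], which lies in [[0, 1)] and so is integral only when it is
    zero. *)
Lemma zero_sum_free_const (a q : nat) :
  (a < q)%N -> zero_sum_free (fun _ : 'I_a => q).
Proof.
move=> aq I; rewrite recip_sum_const => Iint.
have /natrP [k] : #|I|%:R / q%:R \is a @Num.nat rat.
  by rewrite natrEint Iint divr_ge0.
have q0 : q%:R != 0 :> rat by rewrite pnatr_eq0; lia.
move=> /(canRL (divfK q0))/eqP; rewrite -natrM eqr_nat => /eqP e.
have : (#|I| < q)%N.
  by apply: leq_ltn_trans aq; rewrite -[leqRHS]card_ord max_card.
rewrite e => kq; have k0 : k = 0%N by nia.
by apply/eqP; rewrite -cards_eq0 e k0.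
Qed.

(** Used in two ways: with [a = q - 1] to raise the total by almost 1, and with a chosen [a] to
    bring the total just below an integer. *)
Lemma zero_sum_free_extend (T : finType) (n : T -> nat) N a q :
  common_multiple n N -> zero_sum_free n -> coprime N q -> (a < q)%N ->
  exists (U : finType) (n' : U -> nat),
    [/\ common_multiple n' (N * q), zero_sum_free n' &
        recip_sum n' setT = recip_sum n setT + a%:R / q%:R].
Proof.
move=> nN zn Nq aq.
exists (T + 'I_a)%type, (join_fam n (fun _ => q)).
have qq : common_multiple (fun _ : 'I_a => q) q by split=> //; lia.
split; first exact: common_multiple_join.
- by apply: zero_sum_free_join nN qq _ _ _ => //; apply: zero_sum_free_const.
- by rewrite recip_sumT_join recip_sum_const cardsT card_ord.
Qed.

(** [L] stands for the denominators of blocks already built. Coprimality of [c] and [N] is carried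
    along so that [c] can later be inverted modulo [N]. Positivity of [c] fails for the empty
    family, whence the guard [0 < m]. *)
Lemma zero_sum_free_near (L m : nat) :
  (0 < L)%N ->
  exists (T : finType) (n : T -> nat) (N c : nat),
    [/\ common_multiple n N, zero_sum_free n, coprime N L,
        [&& c < N, coprime c N & (0 < m) ==> (0 < c)]%N &
        recip_sum n setT = m%:R - c%:R / N%:R].
Proof.
move=> L0; elim: m => [|m [T [n [N [c [nN zn NL /and3P[cN ccN _] e]]]]]].
  exists void, (fun _ => 1%N), 1%N, 0%N; split=> //.
  - by move=> I _; apply/setP => -[].
  - by rewrite coprime1n.
  - by rewrite /recip_sum mul0r subr0 big1 // => -[].
have N0 := nN.1.
(* This [q] is 1 modulo both [N] and [L], hence coprime to both. It also exceeds [N], which gives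
   [N + c q < N q] for the new numerator. *)
pose q := (N * L + 1)%N.
have qN : coprime N q by rewrite /coprime /q mulnC gcdnMDl gcdn1.
have qL : coprime q L by rewrite coprime_sym /coprime gcdnMDl gcdn1.
have [|U [n' [n'N zn' e']]] := @zero_sum_free_extend T n N q.-1 q nN zn qN.
  by rewrite /q; lia.
(* The numerator comes from [m - c/N + (q - 1)/q = (m + 1) - (N + c q)/(N q)]. *)
exists U, n', (N * q)%N, (N + c * q)%N; split=> //.
- by rewrite coprimeMl NL.
- apply/and3P; split; [by rewrite /q; nia | | by apply/implyP; lia].
  rewrite coprimeMr; apply/andP; split.
    by rewrite coprime_sym /coprime gcdnDl -/(coprime _ _) coprimeMr coprime_sym ccN.
  by rewrite coprime_sym /coprime addnC gcdnMDl -/(coprime _ _) coprime_sym.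
- rewrite e' e -addrA; have -> : q.-1%:R = q%:R - 1 :> rat.
    by rewrite -subn1 natrB // /q; lia.
  have q0 : q%:R != 0 :> rat by rewrite pnatr_eq0 /q; lia.
  have N0' : N%:R != 0 :> rat by rewrite pnatr_eq0; lia.
  by rewrite natrD !natrM -natr1; field; rewrite q0.
Qed.

(** * Indecomposable blocks and their union *)

Lemma indecomposable_block (L m : nat) :
  (0 < L)%N -> (0 < m)%N ->
  exists (T : finType) (n : T -> nat) (M : nat),
    [/\ common_multiple n M, coprime M L, recip_sum n setT = m%:R &
        forall I : {set T},
          recip_sum n I \is a Num.int -> I = set0 \/ I = setT].
Proof.
move=> L0 m0.
have [T [n [N [c [nN zn NL /and3P[cN ccN]]]]]] := zero_sum_free_near m L0.
rewrite m0 /= => c0 e; have N0 := nN.1.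
have [[u v] /= uv] := coprimeP _ c0 ccN.
(* [q] inverts [c] modulo [N], and [q = 1] modulo [L] keeps it coprime to [L]. *)
pose q := chinese N L u 1.
have q1 : (c * q = 1 %[mod N])%N.
  rewrite -modnMmr chinese_modl // modnMmr mulnC.
  have -> : (u * c = v * N + 1)%N by lia.
  by rewrite modnMDl.
have qL : coprime q L.
  by rewrite -coprime_modl /q (chinese_modr NL) coprime_modl coprime1n.
pose a := (c * q %/ N)%N.
have aE : (c * q = a * N + 1)%N.
  by rewrite {1}(divn_eq (c * q) N) q1 modn_small //; lia.
have qN : coprime N q.
  have : coprime N (c * q) by rewrite aE /coprime gcdnMDl gcdn1.
  by rewrite coprimeMr => /andP[].
(* Since [c < N], one has [a N < c q < N q]. *)
have aq : (a < q)%N by nia.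
have [U [n' [n'N zn' e']]] := zero_sum_free_extend nN zn qN aq.
have M0 := n'N.1.
exists (U + unit)%type, (join_fam n' (fun _ => (N * q)%N)), (N * q)%N.
have tot : recip_sum (join_fam n' (fun _ : unit => (N * q)%N)) setT = m%:R.
  rewrite recip_sumT_join recip_sum_const cardsT card_unit e' e.
  have q0 : q%:R != 0 :> rat by rewrite pnatr_eq0; lia.
  have N0' : N%:R != 0 :> rat by rewrite pnatr_eq0; lia.
  have := congr1 (fun k => k%:R : rat) aE; rewrite natrD !natrM => aE'.
  (* Over the denominator [N q] the error has numerator [c q - a N - 1], which vanishes by the
     choice of [a]. *)
  have -> : m%:R - c%:R / N%:R + a%:R / q%:R + 1 / (N%:R * q%:R) =
    m%:R - (c%:R * q%:R - a%:R * N%:R - 1) / (N%:R * q%:R) :> rat.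
    by field; rewrite q0.
  by rewrite aE'; field; rewrite q0.
have noin (I : {set U + unit}) : inr tt \notin I ->
    recip_sum (join_fam n' (fun _ => (N * q)%N)) I \is a Num.int -> I = set0.
  move=> ttI; have e0 : inr @^-1: I = set0 :> {set unit}.
    by apply/setP => -[]; rewrite !inE; apply/negbTE.
  rewrite recip_sum_join e0 recip_sum0 addr0 => /zn' eI.
  by apply: eq_set_sum; rewrite preimset0.
split=> //.
- split=> // -[x|x] //=; exact: n'N.2.
- by rewrite coprimeMl NL.
move=> I Iint; have [ttI|] := boolP (inr tt \in I); last by left; exact: noin.
right; rewrite -[I]setCK (noin (~: I)) ?setC0 //; first by rewrite inE ttI.
by rewrite recip_sumC tot rpredB ?natr_int.
Qed.

(** [blk] sends each fraction to its block, so a union of blocks is a preimage. By induction on [e],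
    the new block is taken coprime to the common multiple of the earlier ones, so an integral sum is
    integral on both sides. *)
Lemma independent_blocks (e : nat) (p : 'I_e -> nat) :
  (forall i, 0 < p i)%N ->
  exists (T : finType) (n : T -> nat) (N : nat) (blk : T -> 'I_e),
    [/\ common_multiple n N,
        forall i, recip_sum n (blk @^-1: [set i]) = (p i)%:R &
        forall I : {set T}, recip_sum n I \is a Num.int ->
          exists S : {set 'I_e}, I = blk @^-1: S].
Proof.
elim: e p => [|e IH] p p0.
  exists void, (fun _ => 1%N), 1%N, (fun x : void => match x with end).
  split=> // [[]//|I _]; exists set0; by apply/setP => -[].
have [T [n [N [blk [nN bp bI]]]]] := IH (p \o lift ord0) (fun i => p0 _).
have [U [n' [M [nM MN tot atom]]]] := indecomposable_block nN.1 (p0 ord0).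
pose blk' (x : T + U) := if x is inl t then lift ord0 (blk t) else ord0.
exists (T + U)%type, (join_fam n n'), (N * M)%N, blk'.
split; first exact: common_multiple_join.
  move=> i; rewrite recip_sum_join; case: (unliftP ord0 i) => [j|] ->.
    have -> : inl @^-1: (blk' @^-1: [set lift ord0 j]) = blk @^-1: [set j].
      by apply/setP => x; rewrite !inE (inj_eq lift_inj).
    have -> : inr @^-1: (blk' @^-1: [set lift ord0 j]) = set0.
      by apply/setP => x; rewrite !inE (negbTE (neq_lift _ _)).
    by rewrite recip_sum0 addr0 bp.
  have -> : inl @^-1: (blk' @^-1: [set ord0]) = set0.
    by apply/setP => x; rewrite !inE eq_sym (negbTE (neq_lift _ _)).
  have -> : inr @^-1: (blk' @^-1: [set ord0]) = setT.
    by apply/setP => x; rewrite !inE eqxx.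
  by rewrite recip_sum0 add0r tot.
move=> I /(recip_sum_join_int nN nM); rewrite coprime_sym => /(_ MN) [].
move=> /bI [S eS] /atom eU.
(* The new block is taken entirely or not at all, so one Boolean decides whether [ord0] belongs to
   the index set. *)
have [b eb] : exists b : bool, inr @^-1: I = [set _ : U | b].
  by case: eU => ->; [exists false | exists true]; apply/setP => x; rewrite !inE.
exists [set i | if unlift ord0 i is Some j then j \in S else b].
apply: eq_set_sum.
  by rewrite eS; apply/setP => x; rewrite !inE liftK.
by rewrite eb; apply/setP => x; rewrite !inE unlift_none.
Qed.

(** * Transfer to families indexed by ordinals *)

Lemma recip_sum_enum_val (T : finType) (n : T -> nat) (I : {set 'I_#|T|}) :
  recip_sum n (enum_val @: I) = \sum_(i in I) (n (enum_val i))%:R^-1.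
Proof. by rewrite /recip_sum big_imset // => x y _ _; apply: enum_val_inj. Qed.

Local Open Scope fset_scope.

Theorem theorem1p2 (m e : nat) (p : 'I_e -> nat)
    (m_gt0 : (0 < m)%N)
    (m_sum : m = (\sum_(i < e) p i)%N)
    (p_bounds : forall i : 'I_e, (1 <= p i <= m)%N)
    (p_mono : forall i j : 'I_e, (i <= j)%N -> (p i <= p j)%N) :
  exists (k : nat) (n : 'I_k -> nat),
    [/\ (0 < k)%N,
        (forall i : 'I_k, (0 < n i)%N),
        m%:R = \sum_(i < k) (n i)%:R^-1 :> rat,
        Omega n = subset_sums (fun i : 'I_e => (p i)%:R) &
        #|[set I : {set 'I_k} |
            \sum_(i in I) ((n i)%:R^-1 : rat) \is a Num.int]| = (2 ^ e)%N].
Proof.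
have p0 i : (0 < p i)%N by have /andP[] := p_bounds i.
have [T [n [N [blk [nN bp bI]]]]] := independent_blocks p0.
pose n' (i : 'I_#|T|) := n (enum_val i).
pose blk' (i : 'I_#|T|) := blk (enum_val i).
have evK (I : {set 'I_#|T|}) : enum_val @^-1: (enum_val @: I) = I.
  by apply/setP => x; rewrite inE mem_imset //; apply: enum_val_inj.
have evK' (I : {set T}) : enum_val @: (@enum_val T T @^-1: I) = I.
  apply/setP => x; apply/imsetP/idP => [[y]|xI]; first by rewrite inE => ? ->.
  by exists (enum_rank x); rewrite ?inE enum_rankK.
have sumS (S : {set 'I_e}) :
    \sum_(i in blk' @^-1: S) (n' i)%:R^-1 = \sum_(i in S) (p i)%:R :> rat.
  rewrite (partition_big blk' [in S]) => [|i]; last by rewrite inE.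
  apply: eq_bigr => j jS; rewrite -bp -[blk @^-1: _]evK' recip_sum_enum_val.
  apply: eq_bigl => i; rewrite !inE /blk'.
  by case: eqP => [->|_]; rewrite ?jS ?andbF.
have intS (I : {set 'I_#|T|}) : \sum_(i in I) (n' i)%:R^-1 \is a @Num.int rat ->
    exists S : {set 'I_e}, I = blk' @^-1: S.
  rewrite -(recip_sum_enum_val n) => /bI [S eS]; exists S.
  by rewrite -[LHS]evK eS; apply/setP => x; rewrite !inE.
have Sint (S : {set 'I_e}) :
    \sum_(i in blk' @^-1: S) (n' i)%:R^-1 \is a @Num.int rat.
  by rewrite sumS -natr_sum natr_int.
have tot : m%:R = \sum_i (n' i)%:R^-1 :> rat.
  transitivity (\sum_(i in blk' @^-1: setT) (n' i)%:R^-1 : rat).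
    by rewrite sumS -natr_sum m_sum; congr _%:R; apply: eq_bigl => i; rewrite inE.
  by apply: eq_bigl => i; rewrite !inE.
exists #|T|, n'; split=> //.
(* An empty family would have total 0, against [0 < m]. *)
- rewrite lt0n; apply/eqP => T0; move/eqP: tot.
  by rewrite big1 ?pnatr_eq0 => [|i]; [lia | have := ltn_ord i; rewrite {2}T0].
- by move=> i; apply: common_multiple_gt0 nN _.
- apply/fsetP => x; rewrite !inE; apply/andP/imfsetP => /=.
    case=> /imfsetP[I _ /= ->] /intS [S ->].
    by exists S => //; rewrite sumS.
  case=> S _ ->; rewrite -sumS; split; last exact: Sint.
  by apply/imfsetP; exists (blk' @^-1: S).
- have -> : [set I : {set 'I_#|T|} |
      \sum_(i in I) ((n' i)%:R^-1 : rat) \is a Num.int] =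
      [set blk' @^-1: S | S : {set 'I_e}].
    apply/setP => I; rewrite inE; apply/idP/imsetP => [/intS [S ->]|[S _ ->]//].
    by exists S.
  rewrite card_imset => [|S S' /setP eS].
    by rewrite -cardsT -powersetT card_powerset cardsT card_ord.
  (* Distinct index sets give distinct unions because no block is empty: block [i] has sum [p i],
     which is positive. *)
  apply/setP => i; have [t ti] : exists t, blk t = i.
    have [/eqP e0|[t]] := set_0Vmem (blk @^-1: [set i]).
      have := bp i; rewrite (eqP e0) recip_sum0 => /esym/eqP.
      by rewrite pnatr_eq0 => /eqP; have := p0 i; lia.
    by rewrite !inE => /eqP; exists t.
  by have := eS (enum_rank t); rewrite !inE /blk' enum_rankK ti.
Qed.
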